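(* Let $\{X_n : n\ge 0\}$ be vertex-reinforced random walk (VRRW) on $\mathbb{Z}$ started at a fixed vertex $v\in\mathbb{Z}$, and let $R=\{k\in\mathbb{Z} : X_n=k \text{ for some } n\ge 0\}$ be its (random) range. Then $\mathbf{P}(|R|=5)>0$ and $\mathbf{P}(|R|<\infty)=1$.
   Context: $\mathbb{Z}$ is viewed as a graph with $x\sim y$ iff $|x-y|=1$. For a process $X_0,X_1,\ldots$ with values in $\mathbb{Z}$, the augmented occupation numbers are $Z(n,x)=1+\sum_{i=0}^n \mathbf{1}_{X_i=x}$ for $x\in\mathbb{Z}$, $n\ge0$. Let $\mathcal{F}_n=\sigma(X_0,\ldots,X_n)$. Vertex-reinforced random walk (VRRW) on $\mathbb{Z}$ with starting point $v$ is the process with $X_0=v$ and $$\mathbf{P}(X_{n+1}=x\mid \mathcal{F}_n)=\mathbf{1}_{x\sim X_n}\,\frac{Z(n,x)}{\sum_{w\sim X_n}Z(n,w)}.$$ *)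

(* Defs.v *)
From HB Require Import structures.
From mathcomp Require Import all_boot all_order all_algebra.
From mathcomp Require Import all_classical all_reals all_analysis.

Set Implicit Arguments.
Unset Strict Implicit.
Unset Printing Implicit Defensive.

Import Order.TTheory GRing.Theory Num.Theory.

Local Open Scope classical_set_scope.
Local Open Scope ring_scope.

(* As for nat in the library, every subset of int is measurable. *)
HB.instance Definition _ := isPointed.Build int 0%N.
HB.instance Definition _ := @isMeasurable.Build default_measure_display
  int (@discrete_measurable int) (@discrete_measurable0 int)
  (@discrete_measurableC int) (@discrete_measurableU int).

Definition Zadj (x y : int) : bool := `|x - y| == 1.

(* The generators of \sigma(X_0, ..., X_n); the sigma-algebra itself is
   <<s history X n >>. *)
Definition history d d' (T : measurableType d) (S : measurableType d')
    (X : nat -> T -> S) (n : nat) : set (set T) :=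
  \bigcup_(i in [set i | (i <= n)%N]) preimage_set_system setT (X i) measurable.

(* Y is a version of the conditional probability of E given the
   sigma-algebra <<s G >>. *)
Definition cond_prob_version d (T : measurableType d) (R : realType)
    (P : probability T R) (G : set (set T)) (E : set T) (Y : T -> R) : Prop :=
  [/\ measurable_fun [set: g_sigma_algebraType G] (Y : g_sigma_algebraType G -> R),
      P.-integrable setT (EFin \o Y) &
      forall A, <<s G >> A -> (\int[P]_(w in A) (Y w)%:E = P (E `&` A))%E].

Definition occupation (T : Type) (X : nat -> T -> int) (n : nat) (x : int)
    (w : T) : nat :=
  (1 + \sum_(0 <= i < n.+1) (X i w == x))%N.

Definition vrrw_step (R : realType) (T : Type) (X : nat -> T -> int) (n : nat)
    (x : int) (w : T) : R :=
  (Zadj x (X n w))%:R * ((occupation X n x w)%:R /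
    \sum_(y \in [set y | Zadj y (X n w)]) ((occupation X n y w)%:R : R)).

Definition VRRW d (T : measurableType d) (R : realType) (P : probability T R)
    (v : int) (X : nat -> {RV P >-> int}) : Prop :=
  {ae P, forall w, X 0%N w = v} /\
  forall (n : nat) (x : int),
    cond_prob_version P (history X n) [set w | X n.+1 w = x]
      (vrrw_step R X n x).

Definition visited (T : Type) (X : nat -> T -> int) (w : T) : set int :=
  [set k | exists n, X n w = k].

(* Main.v *)
Require Import Defs.
From HB Require Import structures.
From mathcomp Require Import all_boot all_order all_algebra finmap.
From mathcomp Require Import all_classical all_reals all_analysis.
From mathcomp Require Import ring lra zify.

(* Write Z(x) for the current occupation number of x.  Both claims rest on
   potentials psi(history) that are supermartingales as long as psi < 1 and have
   value 1 at the exit from a region, so that 1 - psi bounds from below the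
   probability of never leaving the region.

   Finite range: at the first visit of a new maximum m put A = Z(m - 1),
   C = Z(m), D = Z(m + 1), and let U be the initial value of A plus the number of
   later steps from m - 1 to m - 2.  Then U <= Z(m - 2) and U <= A, so
   C / (U + C) is dominated by a Polya urn, while D / C loses about D / C^2 at each
   visit of m and gains in mean at most D / (U C); the surplus also pays for the
   returns from m + 1 to m and for the steps to m + 2, whose mean is D / (A C).
   Hence 6 C / (U + C) + D / (2 C) is such a potential, and it is small if A is large.
   If A is bounded, the walk bounces between m and m + 1 with a probability bounded
   below until m + 2 plays the role of m.  So each new maximum m has a uniformly
   positive chance that m + 4 is never reached; the maximum is a.s. finite, and so
   is the minimum by reflection.

   Five points: with B, C, D, E = Z(v - 1), Z(v + 1), Z(v + 2), Z(v - 2), the exact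
   urn martingale ((C - B)^2 + B + C) / ((B + C) (B + C + 1)) keeps B and C
   comparable, and D / C + E / B controls the steps out of [v - 2, v + 2]. *)

Set Implicit Arguments.
Unset Strict Implicit.
Unset Printing Implicit Defensive.
Import Order.TTheory GRing.Theory Num.Theory numFieldNormedType.Exports.

Local Open Scope classical_set_scope.
Local Open Scope ring_scope.

(** * One-step inequalities for the potentials *)

Section Potentials.
Variable R : realFieldType.
Implicit Types A B C D E U : R.

(* [low], [at0], [at1] are the potential for the walk below m, at m and at m + 1.
   At m the visit counted last has not yet lowered [D / C], hence [C - 1]; at
   m + 1 the return to m is anticipated and the last term is the probability of
   stepping to m + 2 instead. *)
Definition low U C D := 6 * C / (U + C) + D / (2 * C).
Definition at0 U C D := 6 * C / (U + C) + D / (2 * (C - 1)).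
Definition at1 U C D :=
  6 * (C + 1) / (U + C + 1) + D / (2 * C) + (C + 1)^-1.

(** [U <= B] bounds the chance [C / (B + C)] of stepping to m by [C / (U + C)]; what remains is the
    Polya urn martingale [C / (U + C)]. The second term does not move, because [at0] divides by
    [C - 1]. *)
Lemma low_step U B C D : 1 <= U -> U <= B -> 1 <= C ->
  C / (B + C) * at0 U (C + 1) D + B / (B + C) * low (U + 1) C D <= low U C D.
Proof.
move=> U1 UB C1; rewrite /low /at0.
have -> : C + 1 - 1 = C by ring.
have -> : U + (C + 1) = U + C + 1 by ring.
have -> : U + 1 + C = U + C + 1 by ring.
have -> : C / (B + C) * (6 * (C + 1) / (U + C + 1) + D / (2 * C)) +
   B / (B + C) * (6 * C / (U + C + 1) + D / (2 * C)) =
   6 * (C + C / (B + C)) / (U + C + 1) + D / (2 * C).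
  by field; rewrite ?gt_eqF //; lra.
rewrite lerD2r.
have h : C / (B + C) <= C / (U + C).
  by rewrite ler_pM2l ?lef_pV2 ?posrE; lra.
apply: (@le_trans _ _ (6 * (C + C / (U + C)) / (U + C + 1))).
  by rewrite ler_pM2r ?invr_gt0; lra.
rewrite le_eqVlt; apply/orP; left; apply/eqP.
by field; rewrite ?gt_eqF //=; lra.
Qed.

(** The unvisited site m + 2 has weight 1, so the exit, valued 1, contributes [(C + 1)^-1]; the rest
    of [at1] is exactly [at0 U (C + 1) D]. *)
Lemma at1_step U C D : 0 <= U -> 1 <= C -> 0 <= D ->
  C / (C + 1) * at0 U (C + 1) D + (C + 1)^-1 <= at1 U C D.
Proof.
move=> U0 C1 D0; rewrite /at1 /at0.
have -> : C + 1 - 1 = C by ring.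
rewrite addrA lerD2r.
have q : C / (C + 1) <= 1 by rewrite ler_pdivrMr ?mul1r; lra.
have h1 : 0 <= 6 * (C + 1) / (U + C + 1) by rewrite divr_ge0; lra.
have h2 : 0 <= D / (2 * C) by rewrite divr_ge0; lra.
by rewrite -[leRHS]mul1r ler_wpM2r ?addr_ge0.
Qed.

Lemma at0_step A U C D : 2 <= C -> 1 <= D -> 0 <= U -> U <= A ->
  at0 U C D < 1 ->
  A / (A + D) * low U C D + D / (A + D) * at1 U C (D + 1) <= at0 U C D.
Proof.
move=> C2 D1 U0 UA; rewrite /at0 /low /at1 => lt1.
have d0 : 0 <= D / (2 * (C - 1)) by rewrite divr_ge0; lra.
(* [at0 < 1] forces [6 * C < U + C]; the 6 is chosen to give [5 * C <= U <= A], which [pC] needs. *)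
have U5 : 5 * C <= U.
  have : 6 * C / (U + C) < 1 by lra.
  by rewrite ltr_pdivrMr; lra.
have hU : 6 * (C + 1) / (U + C + 1) <= 6 * C / (U + C) + C^-1.
  have -> : 6 * (C + 1) / (U + C + 1) =
     6 * C / (U + C) + (U / (U + C + 1)) * (6 / (U + C)).
    by field; rewrite ?gt_eqF //=; lra.
  rewrite lerD2l -[C^-1]mul1r; apply: ler_pM; rewrite ?divr_ge0; try lra.
    by rewrite ler_pdivrMr; lra.
  by rewrite ler_pdivrMr ?[C^-1 * _]mulrC ?ler_pdivlMr; lra.
have hC : (C + 1)^-1 <= C^-1 by rewrite lef_pV2 ?posrE; lra.
have e1 : (D + 1) / (2 * C) = D / (2 * C) + C^-1 / 2.
  by field; rewrite ?gt_eqF //=; lra.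
have e2 : A / (A + D) = 1 - D / (A + D) by field; rewrite ?gt_eqF //=; lra.
have e3 : D / (2 * (C - 1)) = D / (2 * C) + D / (2 * C * (C - 1)).
  by field; rewrite ?gt_eqF //=; lra.
rewrite e1 e2 e3.
set p := D / (A + D).
have p0 : 0 <= p by rewrite divr_ge0; lra.
(* In units of [C^-1], a step to m + 1 raises the urn term by at most 1, the D term by [1 / 2], and
   adds at most 1 for the exit. The right side is the drop from [D / (2 * (C - 1))] to
   [D / (2 * C)]. *)
have pC : p * (5 / 2 * C^-1) <= D / (2 * C * (C - 1)).
  rewrite /p; have -> : D / (A + D) * (5 / 2 * C^-1) = D * (5 / (A + D)) / (2 * C).
    by field; rewrite ?gt_eqF //=; lra.
  have -> : D / (2 * C * (C - 1)) = D * (C - 1)^-1 / (2 * C).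
    by field; rewrite ?gt_eqF //=; lra.
  rewrite ler_pM2r ?invr_gt0; last lra.
  rewrite ler_pM2l; last lra.
  by rewrite ler_pdivrMr ?[_^-1 * _]mulrC ?ler_pdivlMr; lra.
set x := 6 * C / (U + C) in hU *; set y := _ / (U + C + 1) in hU *.
set z := D / (2 * C) in pC *; set i := C^-1 in hU hC pC *.
set j := (C + 1)^-1 in hC *; set k := D / _ in pC *.
have : p * (y + (z + i / 2) + j - (x + z)) <= p * (5 / 2 * i).
  by rewrite ler_wpM2l //; lra.
lra.
Qed.

(** The mean of [(2 p - 1)^2] for p of law Beta(B, C), the limiting fraction in a Polya urn started
    from B and C; hence a martingale for that urn. *)
Definition spread B C := ((C - B) ^+ 2 + (B + C)) / ((B + C) * (B + C + 1)).

Lemma spreadC B C : spread B C = spread C B.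
Proof. by rewrite /spread -sqrrN opprB [B + C]addrC. Qed.

(* [psi0], [psi1], [psi2] are the five-point potential at v, v + 1 and v + 2; the
   sites v - 1 and v - 2 are obtained by exchanging (B, E) and (C, D). *)
Definition psi0 B C D E := 4 * spread B C + 40 * (D / C + E / B).
Definition psi1 B C D E := 4 * spread B C + 40 * (D / (C - 1) + E / B).
Definition psi2 B C D E :=
  4 * spread B (C + 1) + 40 * (D / C + E / B) + (C + 1)^-1.

(** [spread] is an urn martingale, and the [C - 1] in [psi1] keeps [D / C] unchanged on arrival;
    hence equality. *)
Lemma psi0_step B C D E : 1 <= B -> 1 <= C ->
  C / (B + C) * psi1 B (C + 1) D E + B / (B + C) * psi1 C (B + 1) E D =
  psi0 B C D E.
Proof.
move=> B1 C1; rewrite /psi0 /psi1 /spread.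
have -> : C + 1 - 1 = C by ring.
have -> : B + 1 - 1 = B by ring.
by field; rewrite ?gt_eqF //=; lra.
Qed.

Lemma spread_ge0 B C : 0 <= B -> 0 <= C -> 0 <= spread B C.
Proof.
by move=> B0 C0; rewrite divr_ge0 ?mulr_ge0 ?addr_ge0 ?sqr_ge0.
Qed.

Lemma psi2_step B C D E : 1 <= B -> 1 <= C -> 0 <= D -> 0 <= E ->
  C / (C + 1) * psi1 B (C + 1) D E + (C + 1)^-1 <= psi2 B C D E.
Proof.
move=> B1 C1 D0 E0; rewrite /psi1 /psi2 lerD2r.
have -> : C + 1 - 1 = C by ring.
have q : C / (C + 1) <= 1 by rewrite ler_pdivrMr ?mul1r; lra.
have d0 : 0 <= D / C by rewrite divr_ge0; lra.
have e0 : 0 <= E / B by rewrite divr_ge0; lra.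
have s0 : 0 <= spread B (C + 1) by rewrite spread_ge0; lra.
by rewrite -[leRHS]mul1r ler_wpM2r //; lra.
Qed.

(** As in [at0_step], the drop from [D / (C - 1)] to [D / C] pays for a step to v + 2. The lower
    bound on A = Z(v) comes from [inv], the alternation of even and odd sites. *)
Lemma psi1_step A B C D E : 2 <= C -> 1 <= B -> 1 <= D -> 1 <= E -> 1 <= A ->
  B + C <= A + D + E + 1 -> psi1 B C D E < 1 ->
  A / (A + D) * psi0 B C D E + D / (A + D) * psi2 B C (D + 1) E <=
  psi1 B C D E.
Proof.
move=> C2 B1 D1 E1 A1 inv; rewrite /psi0 /psi1 /psi2 => lt1.
have d0 : 0 <= D / (C - 1) by rewrite divr_ge0; lra.
have e0 : 0 <= E / B by rewrite divr_ge0; lra.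
have s0 : 0 <= spread B C by rewrite spread_ge0; lra.
have EB : 40 * E < B.
  have : 40 * (E / B) < 1 by lra.
  by rewrite mulrA ltr_pdivrMr; lra.
(* [4 * spread B C < 1] yields [(3 * B - C) * (3 * C - B) > 0], which [C > 3 * B] contradicts. *)
have BC : C <= 3 * B.
  have : 4 * spread B C < 1 by lra.
  rewrite /spread mulrA ltr_pdivrMr ?mulr_gt0 ?mul1r; try lra.
  move=> hs; rewrite leNgt; apply/negP => hc.
  have : 0 <= (3 * C - B) * (C - 3 * B) by rewrite mulr_ge0; lra.
  lra.
have hs : spread B (C + 1) <= spread B C + 2 / C.
  have -> : spread B (C + 1) = spread B C
     + (2 * (C - B) + 2) / ((B + C + 1) * (B + C + 2))
     - 2 * ((C - B) ^+ 2 + (B + C)) / ((B + C) * (B + C + 1) * (B + C + 2)).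
    by rewrite /spread; field; rewrite ?gt_eqF //=; lra.
  have h1 : 0 <= 2 * ((C - B) ^+ 2 + (B + C)) / ((B + C) * (B + C + 1) * (B + C + 2)).
    by rewrite divr_ge0 ?mulr_ge0 ?addr_ge0 ?sqr_ge0; lra.
  have h2 : (2 * (C - B) + 2) / ((B + C + 1) * (B + C + 2)) <= 2 / C.
    rewrite ler_pdivrMr ?mulr_gt0; try lra.
    rewrite mulrAC ler_pdivlMr; last lra.
    nra.
  lra.
have hC : (C + 1)^-1 <= C^-1 by rewrite lef_pV2 ?posrE; lra.
have e1 : (D + 1) / C = D / C + C^-1.
  by field; rewrite ?gt_eqF //=; lra.
have e2 : A / (A + D) = 1 - D / (A + D) by field; rewrite ?gt_eqF //=; lra.
have e3 : D / (C - 1) = D / C + D / (C * (C - 1)).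
  by field; rewrite ?gt_eqF //=; lra.
rewrite e1 e2 e3.
set p := D / (A + D).
have p0 : 0 <= p by rewrite divr_ge0; lra.
(* 49 = 4 * 2 + 40 + 1, from [hs], the growth of D and the exit. By [inv], [EB] and [BC], [40 * (A +
   D) >= 40 * (C - 1) + 39 * B >= 49 * (C - 1)]. *)
have pC : p * (49 * C^-1) <= 40 * (D / (C * (C - 1))).
  rewrite /p; have -> : D / (A + D) * (49 * C^-1) = D * (49 / (A + D)) / C.
    by field; rewrite ?gt_eqF //=; lra.
  have -> : 40 * (D / (C * (C - 1))) = D * (40 / (C - 1)) / C.
    by field; rewrite ?gt_eqF //=; lra.
  rewrite ler_pM2r ?invr_gt0; last lra.
  rewrite ler_pM2l; last lra.
  rewrite ler_pdivrMr; last lra.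
  by rewrite mulrAC ler_pdivlMr; lra.
set x := spread B C in hs *; set y := spread B (C + 1) in hs *.
set z := D / C; set i := C^-1 in hs hC pC *; set t := E / B.
set j := (C + 1)^-1 in hC *; set k := D / _ in pC *.
have : p * (4 * y + 40 * (z + i + t) + j - (4 * x + 40 * (z + t))) <= p * (49 * i).
  by rewrite ler_wpM2l //; lra.
lra.
Qed.
End Potentials.

(** * Histories and probabilities of confinement over n steps *)

Section Paths.
Variable R : realFieldType.
Implicit Types (s : seq int) (x m v : int) (phi : pred (seq int)).

(* A history is stored with its most recent site first. *)
Definition pos s : int := head 0 s.
Definition occ s x : nat := (count_mem x s).+1.
#[global] Arguments occ s x%_R.

Lemma occ_cons s x y : occ (x :: s) y = ((x == y) + occ s y)%N.
Proof. by rewrite /occ /= addnS. Qed.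

Lemma occ_notin s x : x \notin s -> occ s x = 1%N.
Proof. by move=> h; rewrite /occ (count_memPn h). Qed.

Definition Zr s x : R := (occ s x)%:R.

Lemma Zr_cons s x y : Zr (x :: s) y = (x == y)%:R + Zr s y.
Proof. by rewrite /Zr occ_cons natrD. Qed.

Lemma Zr_ge1 s x : 1 <= Zr s x.
Proof. by rewrite /Zr ler1n. Qed.

Definition up s : R :=
  Zr s (pos s + 1) / (Zr s (pos s - 1) + Zr s (pos s + 1)).
Definition dn s : R :=
  Zr s (pos s - 1) / (Zr s (pos s - 1) + Zr s (pos s + 1)).

Lemma up_gt0 s : 0 < up s.
Proof.
by have := Zr_ge1 s (pos s + 1); have := Zr_ge1 s (pos s - 1) => *;
   rewrite divr_gt0; lra.
Qed.

Lemma dn_gt0 s : 0 < dn s.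
Proof.
by have := Zr_ge1 s (pos s + 1); have := Zr_ge1 s (pos s - 1) => *;
   rewrite divr_gt0; lra.
Qed.

Lemma up_dn s : up s + dn s = 1.
Proof.
rewrite /up /dn; have := Zr_ge1 s (pos s + 1); have := Zr_ge1 s (pos s - 1) => *.
by field; rewrite gt_eqF //; lra.
Qed.

(* The probability that the history satisfies [phi] after [n] more steps from [s]. *)
Fixpoint Ev n phi s : R :=
  if n is n'.+1 then
    up s * Ev n' phi (pos s + 1 :: s) + dn s * Ev n' phi (pos s - 1 :: s)
  else (phi s)%:R.

Lemma Ev_ge0 n phi s : 0 <= Ev n phi s.
Proof.
elim: n s => [|n IH] s //=.
by rewrite addr_ge0 // mulr_ge0 // ltW ?up_gt0 ?dn_gt0.
Qed.

Lemma Ev_mono n (phi psi : pred (seq int)) s : (forall t, phi t -> psi t) ->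
  Ev n phi s <= Ev n psi s.
Proof.
move=> h; elim: n s => [|n IH] s /=.
  by rewrite ler_nat; case e : (phi s) => //; rewrite (h _ e).
by rewrite lerD // ler_wpM2l // ltW ?up_gt0 ?dn_gt0.
Qed.

Lemma Ev_all_false n (q : pred int) s : ~~ all q s -> Ev n (all q) s = 0.
Proof.
elim: n s => [|n IH] s hs /=; first by rewrite (negbTE hs).
by rewrite !IH ?mulr0 ?addr0 //= negb_and hs orbT.
Qed.

(** Uniform in n, so that continuity from above turns it into a bound for all times. *)
Definition good phi (c : R) s := forall n, c <= Ev n phi s.

Lemma good_up phi (p c : R) s : phi s ->
  0 <= p <= up s -> 0 <= c <= 1 ->
  good phi c (pos s + 1 :: s) -> good phi (p * c) s.
Proof.
move=> phis /andP[p0 pu] /andP[c0 c1] h [|n] /=.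
  rewrite phis mulr_ile1 //; apply: le_trans pu _.
  by rewrite -(up_dn s) lerDl ltW ?dn_gt0.
rewrite -[p * c]addr0 lerD ?ler_pM // mulr_ge0 ?Ev_ge0 //.
by rewrite ltW ?dn_gt0.
Qed.

Lemma good_dn phi (p c : R) s : phi s ->
  0 <= p <= dn s -> 0 <= c <= 1 ->
  good phi c (pos s - 1 :: s) -> good phi (p * c) s.
Proof.
move=> phis /andP[p0 pu] /andP[c0 c1] h [|n] /=.
  rewrite phis mulr_ile1 //; apply: le_trans pu _.
  by rewrite -(up_dn s) lerDr ltW ?up_gt0.
rewrite -[p * c]add0r lerD ?ler_pM // mulr_ge0 ?Ev_ge0 //.
by rewrite ltW ?up_gt0.
Qed.

(** The induction step of the supermartingale bounds: h dominates the mean over the two successors,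
    where an exit has the value 1. *)
Lemma Ev_step n phi s (h hu hd : R) :
  1 - hu <= Ev n phi (pos s + 1 :: s) -> 1 - hd <= Ev n phi (pos s - 1 :: s) ->
  up s * hu + dn s * hd <= h -> 1 - h <= Ev n.+1 phi s.
Proof.
move=> Hu Hd H /=.
have h1 : up s * (1 - hu) <= up s * Ev n phi (pos s + 1 :: s).
  by rewrite ler_wpM2l // ltW ?up_gt0.
have h2 : dn s * (1 - hd) <= dn s * Ev n phi (pos s - 1 :: s).
  by rewrite ler_wpM2l // ltW ?dn_gt0.
have := up_dn s.
move: (up s) (dn s) h1 h2 H => u d; lra.
Qed.

Definition below m : pred int := fun x => x < m.

Ltac zr e := rewrite ?Zr_cons ?eqxx;
  repeat match goal with |- context [ (?x == ?y :> int) ] =>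
    (have -> : (x == y) = false by clear - e; lia) ||
    (have -> : (x == y) by clear -e; lia) end;
  rewrite ?add0r ?mulr1n ?mulr0n.

Section Barrier.
Variable m : int.

Definition psi_max (U : R) s : R :=
  if pos s == m + 1 then at1 U (Zr s m) (Zr s (m + 1))
  else if pos s == m then at0 U (Zr s m) (Zr s (m + 1))
  else low U (Zr s m) (Zr s (m + 1)).

Lemma psi_max_low U s : pos s < m ->
  psi_max U s = low U (Zr s m) (Zr s (m + 1)).
Proof. by move=> h; rewrite /psi_max !ifN //; lia. Qed.

Lemma psi_max_at0 U s : pos s = m ->
  psi_max U s = at0 U (Zr s m) (Zr s (m + 1)).
Proof. by move=> h; rewrite /psi_max h eqxx ifN //; lia. Qed.

Lemma psi_max_at1 U s : pos s = m + 1 ->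
  psi_max U s = at1 U (Zr s m) (Zr s (m + 1)).
Proof. by move=> h; rewrite /psi_max h eqxx. Qed.

(** U grows only on a step from m - 1 to m - 2. The indicator in the hypothesis on [occ s (m - 1)]
    reserves the current visit of m - 1 for this growth, so [U <= A] survives. Below m - 1 the
    potential is constant. *)
Lemma Ev_below n (U : nat) s :
  all (below (m + 2)) s -> (0 < size s)%N ->
  (1 <= U)%N -> (U <= occ s (m - 2))%N -> (U + (pos s == m - 1)%R <= occ s (m - 1))%N ->
  (2 <= occ s m)%N ->
  1 - psi_max U%:R s <= Ev n (all (below (m + 2))) s.
Proof.
elim: n U s => [|n IH] U s sb s0 U1 UB UA C2.
  have C1 : 2 <= Zr s m by rewrite ler_nat.
  have D1 := Zr_ge1 s (m + 1).
  have U1' : 1 <= U%:R :> R by rewrite ler1n.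
  rewrite /= sb gerBl /psi_max; case: ifP => _; [|case: ifP => _];
    rewrite /at1 /at0 /low ?addr_ge0 ?divr_ge0 ?invr_ge0 //; lra.
have sm : pos s < m + 2 by case: s sb s0 {UB UA C2} => //= x s /andP[].
have C1 : 2 <= Zr s m by rewrite ler_nat.
have D1 := Zr_ge1 s (m + 1).
have U1' : 1 <= U%:R :> R by rewrite ler1n.
have IHn : forall (V : nat) x, x < m + 2 -> (1 <= V)%N ->
   (V <= (x == m - 2)%R + occ s (m - 2))%N ->
   (V + (x == m - 1)%R <= (x == m - 1)%R + occ s (m - 1))%N ->
   1 - psi_max V%:R (x :: s) <= Ev n (all (below (m + 2))) (x :: s).
  move=> V x xm V1 VB VA; apply: IH => //=; rewrite ?occ_cons //.
    by rewrite /below xm.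
  by rewrite ltn_addl.
have [e|[e|[e|e]]] : pos s = m + 1 \/ pos s = m \/ pos s = m - 1 \/ pos s < m - 1 by lia.
- have o : occ s (m + 2) = 1%N.
    apply: occ_notin; apply/negP => h; move/allP: sb => /(_ _ h).
    by rewrite /below ltxx.
  apply: (@Ev_step _ _ _ _ 1 (psi_max U%:R (pos s - 1 :: s))).
  + by rewrite subrr Ev_ge0.
  + by apply: IHn => //; lia.
  rewrite psi_max_at0 ?psi_max_at1 ?e //=; last lia.
  have -> : m + 1 - 1 = m by lia.
  zr e.
  apply: le_trans (at1_step _ _ _) => //; try lra.
  rewrite /up /dn e.
  have -> : m + 1 + 1 = m + 2 by lia.
  have -> : m + 1 - 1 = m by lia.
  have -> : Zr s (m + 2) = 1 by rewrite /Zr o.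
  by rewrite mulr1 div1r addrC [1 + Zr s m]addrC.
(* [at0_step] needs a potential below 1; otherwise the bound is trivial, as [Ev] is nonnegative. *)
- have [h|h] := leP 1 (psi_max U%:R s).
    by apply: le_trans (Ev_ge0 _ _ _); lra.
  apply: (@Ev_step _ _ _ _ (psi_max U%:R (pos s + 1 :: s))
    (psi_max U%:R (pos s - 1 :: s))).
  + by apply: IHn => //; lia.
  + by apply: IHn => //; lia.
  move: h; rewrite psi_max_at0 // psi_max_at1 ?e //
    psi_max_low /=; last lia.
  zr e => h.
  rewrite [leLHS]addrC /up /dn e [1 + Zr s (m + 1)]addrC.
  apply: at0_step => //.
  by rewrite /Zr ler_nat; lia.
- apply: (@Ev_step _ _ _ _ (psi_max U%:R (pos s + 1 :: s))
    (psi_max U.+1%:R (pos s - 1 :: s))).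
  + by apply: IHn => //; lia.
  + by apply: IHn => //; lia.
  rewrite [psi_max _ s]psi_max_low ?[psi_max _ (_ - _ :: _)]psi_max_low
    ?psi_max_at0 ?e /=; try lia.
  zr e.
  rewrite /up /dn e -[U.+1]addn1 natrD [1 + _]addrC.
  have -> : m - 1 - 1 = m - 2 by lia.
  have -> : m - 1 + 1 = m by lia.
  apply: low_step => //; last lra.
  by rewrite /Zr ler_nat.
- apply: (@Ev_step _ _ _ _ (psi_max U%:R (pos s + 1 :: s))
    (psi_max U%:R (pos s - 1 :: s))).
  + by apply: IHn => //; lia.
  + by apply: IHn => //; lia.
  rewrite [psi_max _ s]psi_max_low ?psi_max_low /=; try lia.
  zr e.
  by rewrite -mulrDl up_dn mul1r.
Qed.

(** With C = 2, D = 1 and U = a the potential is [12 / (a + 2) + 1 / 2], at most [3 / 4] as soon as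
    a >= 46. *)
Lemma good_below s : pos s = m -> all (below (m + 1)) s -> occ s m = 2%N ->
  (46 <= occ s (m - 1))%N -> (occ s (m - 1) <= occ s (m - 2))%N ->
  good (all (below (m + 2))) 4^-1 s.
Proof.
move=> e sb o2 a46 ab n.
have o1 : occ s (m + 1) = 1%N.
  apply: occ_notin; apply/negP => h; move/allP: sb => /(_ _ h).
  by rewrite /below ltxx.
have sb2 : all (below (m + 2)) s by apply: sub_all sb => x; rewrite /below; lia.
have s0 : (0 < size s)%N by case: s o2 {e sb a46 ab o1 sb2}.
have : 1 - psi_max (occ s (m - 1))%:R s <= Ev n (all (below (m + 2))) s.
  apply: Ev_below => //; rewrite ?o2 //.
  by rewrite e (_ : (m == m - 1) = false) ?addn0 //; lia.
apply: le_trans; rewrite psi_max_at0 // /Zr o2 o1.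
have : 46 <= (occ s (m - 1))%:R :> R by rewrite ler_nat.
move: (occ s (m - 1))%:R => a a4; rewrite /at0.
have : 6 * 2 / (a + 2) <= 4^-1 by rewrite ler_pdivrMr; lra.
rewrite (_ : 2 * (2 - 1) = 2); [lra|ring].
Qed.

End Barrier.

(** * A uniform chance of stopping soon after a new maximum *)

Lemma below_occ m s x : all (below m) s -> m <= x -> occ s x = 1%N.
Proof.
move=> sb mx; apply: occ_notin; apply/negP => h.
by move/allP: sb => /(_ _ h); rewrite /below; lia.
Qed.

(** j counts the bounces done from m to m + 1 and back, k those left. After 50 of them and two steps
    up to m + 2, both m and m + 1 have occupation 52, so [good_below] applies with m + 2 for m; 46
    is its threshold. *)
Lemma bounce (k j : nat) : (j + k = 50)%N ->
  exists2 c : R, 0 < c <= 1 & forall m s, pos s = m -> all (below (m + 2)) s ->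
    (occ s (m - 1) <= 46)%N -> occ s m = j.+2 -> occ s (m + 1) = j.+1 ->
    good (all (below (m + 4))) c s.
Proof.
elim: k j => [|k IH] j jk.
  (* [(j + 1) / (a + j + 1) >= 1 / 47] for a <= 46 bounds the step to m + 1; [53^-1] is the step to
     m + 2 against weight 52 at m; [4^-1] is from [good_below]. *)
  exists (47^-1 * (53^-1 * 4^-1)); first by lra.
  move=> m s e sb a46 oC oD.
  have sb4 : all (below (m + 4)) s by apply: sub_all sb => x; rewrite /below; lia.
  apply: good_up; [by []| |by lra|].
    rewrite /up e /Zr oD.
    have : (occ s (m - 1))%:R <= 46 :> R by rewrite ler_nat.
    have := ler0n R (occ s (m - 1)); have := ler0n R j.
    rewrite -[j.+1]addn1 natrD; move: (occ s _)%:R j%:R => a t *.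
    apply/andP; split; first lra.
    by rewrite ler_pdivlMr; lra.
  have e1 : pos (pos s + 1 :: s) = m + 1 by rewrite /= e.
  apply: good_up; [| |by lra|].
  - by rewrite /= sb4 andbT /below e; lia.
  - rewrite /up e1 /Zr !occ_cons e.
    have -> : m + 1 + 1 = m + 2 by lia.
    have -> : m + 1 - 1 = m by lia.
    rewrite (below_occ sb) // oC (_ : j = 50%N); last lia.
    have -> : (m + 1 == m) = false by lia.
    have -> : (m + 1 == m + 2) = false by lia.
    by rewrite !add0n -natrD div1r (_ : (50.+2 + 1)%N = 53%N) //; lra.
  rewrite e1 e; have -> : m + 1 + 1 = m + 2 by lia.
  have -> : m + 4 = m + 2 + 2 by lia.
  apply: good_below => //.
  - rewrite /= /below; apply/and3P; split; [lia..|].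
    by apply: sub_all sb => x; rewrite /below; lia.
  - rewrite !occ_cons (below_occ sb) // eqxx.
    by have -> : (m + 1 == m + 2) = false by lia.
  - have -> : m + 2 - 1 = m + 1 by lia.
    by rewrite !occ_cons oD; lia.
  have -> : m + 2 - 1 = m + 1 by lia.
  have -> : m + 2 - 2 = m by lia.
  by rewrite !occ_cons oD oC; lia.
have [|c c01 H] := IH j.+1; first lia.
(* One bounce: [47^-1] as before, and [3^-1] for the return, of probability [(j + 2) / (j + 3)]. *)
exists (47^-1 * (3^-1 * c)); first by lra.
move=> m s e sb a46 oC oD.
have sb4 : all (below (m + 4)) s by apply: sub_all sb => x; rewrite /below; lia.
have e1 : pos (pos s + 1 :: s) = m + 1 by rewrite /= e.
apply: good_up; [by []| |by lra|].
  rewrite /up e /Zr oD.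
  have : (occ s (m - 1))%:R <= 46 :> R by rewrite ler_nat.
  have := ler0n R (occ s (m - 1)); have := ler0n R j.
  rewrite -[j.+1]addn1 natrD; move: (occ s _)%:R j%:R => a t *.
  apply/andP; split; first lra.
    by rewrite ler_pdivlMr; lra.
apply: good_dn; [| |by lra|].
- by rewrite /= sb4 andbT /below e; lia.
- rewrite /dn e1 /Zr !occ_cons e.
  have -> : m + 1 + 1 = m + 2 by lia.
  have -> : m + 1 - 1 = m by lia.
  rewrite (@below_occ _ _ (m + 2) sb) // oC.
  have -> : (m + 1 == m) = false by lia.
  have -> : (m + 1 == m + 2) = false by lia.
  rewrite !add0n -[j.+2]addn2 natrD; have := ler0n R j.
  by move: j%:R => t *; rewrite ler_pdivlMr; lra.
rewrite e1 e; have -> : m + 1 - 1 = m by lia.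
apply: H => //.
- rewrite /= /below; apply/and3P; split; [lia..|].
  by apply: sub_all sb => x; rewrite /below; lia.
- by rewrite !occ_cons; lia.
- by rewrite !occ_cons oC; lia.
by rewrite !occ_cons oD; lia.
Qed.

(* At the first visit of m the site m - 2 has been visited at least as often as
   m - 1: that is what lets [U] start at [occ s (m - 1)] in [Ev_below]. *)
Lemma good_first_visit : exists2 c : R, 0 < c <= 1 & forall m s,
  pos s = m -> all (below (m + 1)) s -> occ s m = 2%N ->
  (occ s (m - 1) <= occ s (m - 2))%N -> good (all (below (m + 4))) c s.
Proof.
have [|c /andP[c0 c1] H] := @bounce 50 0; first by [].
exists (c * 4^-1); first by lra.
move=> m s e sb o2 ab n.
have [a46|a46] := leqP 46 (occ s (m - 1)).
  have h := good_below e sb o2 a46 ab n.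
  apply: (@le_trans _ _ 4^-1); first by lra.
  apply: (le_trans h); apply: Ev_mono => t.
  by apply: sub_all => x; rewrite /below; lia.
apply: (@le_trans _ _ c); first by lra.
apply: H => //.
- by apply: sub_all sb => x; rewrite /below; lia.
- by rewrite ltnW.
by rewrite (below_occ sb).
Qed.

(** Conditioning on the first visit of m. Until then m - 1 is entered only from m - 2, which
    preserves the inequality between their occupation numbers; at that visit H leaves a chance of at
    most 1 - c to reach m + 4. *)
Lemma Ev_hit (c : R) n m s : 0 <= c <= 1 ->
  (forall t, pos t = m -> all (below (m + 1)) t -> occ t m = 2%N ->
    (occ t (m - 1) <= occ t (m - 2))%N -> good (all (below (m + 4))) c t) ->
  all (below m) s -> (0 < size s)%N ->
  (occ s (m - 1) + (pos s == m - 2)%R <= occ s (m - 2))%N ->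
  1 - Ev n (all (below (m + 4))) s <= (1 - c) * (1 - Ev n (all (below m)) s).
Proof.
move=> c01 H; elim: n s => [|n IH] s sb s0 inv.
  rewrite /= sb (_ : all _ s) ?subrr ?mulr0 //.
  by apply: sub_all sb => x; rewrite /below; lia.
have sm : pos s < m by case: s sb s0 {inv} => //= x s /andP[].
have step x : x <= m -> x = pos s + 1 \/ x = pos s - 1 ->
   1 - Ev n (all (below (m + 4))) (x :: s) <=
   (1 - c) * (1 - Ev n (all (below m)) (x :: s)).
  move=> xm xs; have [xe|xne] := eqVneq x m.
    rewrite (@Ev_all_false _ (below m)) /=; last by rewrite /below xe ltxx.
    rewrite subr0 mulr1 lerD2l lerN2; apply: H => //=.
    - rewrite /below xe; apply/andP; split; first lia.
      by apply: sub_all sb => y; rewrite /below; lia.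
    - by rewrite occ_cons xe eqxx (below_occ sb).
    by rewrite !occ_cons; lia.
  apply: IH => //=; first by rewrite sb andbT /below; lia.
  by rewrite !occ_cons; lia.
have h1 := step (pos s + 1) ltac:(lia) ltac:(by left).
have h2 := step (pos s - 1) ltac:(lia) ltac:(by right).
have g1 : up s * (1 - Ev n (all (below (m + 4))) (pos s + 1 :: s)) <=
  up s * ((1 - c) * (1 - Ev n (all (below m)) (pos s + 1 :: s))).
  by rewrite ler_wpM2l // ltW ?up_gt0.
have g2 : dn s * (1 - Ev n (all (below (m + 4))) (pos s - 1 :: s)) <=
  dn s * ((1 - c) * (1 - Ev n (all (below m)) (pos s - 1 :: s))).
  by rewrite ler_wpM2l // ltW ?dn_gt0.
have := up_dn s => /=.
move: (up s) (dn s) g1 g2 => u d g1 g2 ud.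
have -> : u = 1 - d by lra.
move: g1 g2; have -> : u = 1 - d by lra.
lra.
Qed.

(** [Ev_hit] is iterated over barriers 4 apart. The first is v + 2: there v plays the role of m - 2,
    and the initial inequality reads 1 + 1 <= 2. *)
Lemma Ev_below_geometric : exists2 c : R, 0 < c <= 1 & forall n v k,
  1 - Ev n (all (below (v + 2 + 4 * k%:Z))) [:: v] <= (1 - c) ^+ k.
Proof.
have [c /andP[c0 c1] H] := good_first_visit.
exists c; first by rewrite c0.
move=> n v; elim=> [|k IH]; first by rewrite expr0 gerBl Ev_ge0.
have -> : v + 2 + 4 * k.+1%:Z = (v + 2 + 4 * k%:Z) + 4 by lia.
apply: le_trans (Ev_hit (c := c) _ _ _ _ _ _) _ => //.
- by rewrite ltW.
- by move=> t; exact: H.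
- by rewrite /= /below; lia.
- by rewrite !occ_cons /= !(@occ_notin [::]) //; lia.
by rewrite exprS ler_wpM2l // subr_ge0.
Qed.

(** * Confinement to five sites *)

Lemma psi0C (B C D E : R) : psi0 B C D E = psi0 C B E D.
Proof. by rewrite /psi0 spreadC [D / C + _]addrC. Qed.

Section Trap.
Variable v : int.

Definition within : pred int := fun x => `|x - v| <= 2.

Definition psi_trap s : R :=
  let B := Zr s (v - 1) in let C := Zr s (v + 1) in
  let D := Zr s (v + 2) in let E := Zr s (v - 2) in
  if pos s == v then psi0 B C D E
  else if pos s == v + 1 then psi1 B C D E
  else if pos s == v - 1 then psi1 C B E D
  else if pos s == v + 2 then psi2 B C D E
  else psi2 C B E D.

Lemma psi_trap_ge0 s : 2 <= Zr s (v - 1) -> 2 <= Zr s (v + 1) -> 0 <= psi_trap s.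
Proof.
move=> B2 C2; have D1 := Zr_ge1 s (v + 2); have E1 := Zr_ge1 s (v - 2).
have q (B C D E : R) : 2 <= B -> 2 <= C -> 1 <= D -> 1 <= E ->
    [/\ 0 <= psi0 B C D E, 0 <= psi1 B C D E & 0 <= psi2 B C D E].
  move=> b c d e; have s0 : 0 <= spread B C by rewrite spread_ge0; lra.
  have s1 : 0 <= spread B (C + 1) by rewrite spread_ge0; lra.
  have d0 : 0 <= D / C by rewrite divr_ge0; lra.
  have d1 : 0 <= D / (C - 1) by rewrite divr_ge0; lra.
  have e0 : 0 <= E / B by rewrite divr_ge0; lra.
  have c0 : 0 <= (C + 1)^-1 by rewrite invr_ge0; lra.
  by rewrite /psi0 /psi1 /psi2; split; lra.
have [? ? ?] := q _ _ _ _ B2 C2 D1 E1; have [? ? ?] := q _ _ _ _ C2 B2 E1 D1.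
by rewrite /psi_trap; repeat case: ifP => _.
Qed.

(** The walk alternates between v - 1, v + 1 and the three other sites, which preserves the last
    hypothesis; its indicator accounts for a current visit of v - 1 or v + 1. The cases v - 1 and v
    - 2 mirror v + 1 and v + 2. *)
Lemma Ev_trap n s : all within s -> (0 < size s)%N ->
  (2 <= occ s (v - 1))%N -> (2 <= occ s (v + 1))%N ->
  (occ s (v - 1) + occ s (v + 1) <=
    occ s v + occ s (v + 2) + occ s (v - 2) + (`|pos s - v| == 1)%R)%N ->
  1 - psi_trap s <= Ev n (all within) s.
Proof.
elim: n s => [|n IH] s sb s0 oB oC inv.
  by rewrite /= sb gerBl psi_trap_ge0 // ler_nat.
have sv : within (pos s) by case: s sb s0 {oB oC inv} => //= x s /andP[].
have B2 : 2 <= Zr s (v - 1) by rewrite ler_nat.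
have C2 : 2 <= Zr s (v + 1) by rewrite ler_nat.
have A1 := Zr_ge1 s v; have D1 := Zr_ge1 s (v + 2); have E1 := Zr_ge1 s (v - 2).
have IHn x : within x -> x = pos s + 1 \/ x = pos s - 1 ->
    1 - psi_trap (x :: s) <= Ev n (all within) (x :: s).
  move=> xw xs; apply: IH => //=; rewrite ?occ_cons ?xw //.
  - by rewrite ltn_addl.
  - by rewrite ltn_addl.
  by move: sv xw xs; rewrite /within; clear -inv; lia.
have [h|h] := leP 1 (psi_trap s).
  by apply: le_trans (Ev_ge0 _ _ _); lra.
have inv' : Zr s (v - 1) + Zr s (v + 1) <= Zr s v + Zr s (v + 2) + Zr s (v - 2)
   + (`|pos s - v| == 1)%:R.
  by rewrite /Zr -!natrD ler_nat.
have [e|[e|[e|[e|e]]]] : pos s = v \/ pos s = v + 1 \/ pos s = v - 1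
    \/ pos s = v + 2 \/ pos s = v - 2.
  by move: sv; rewrite /within; clear; lia.
- apply: (@Ev_step _ _ _ _ (psi_trap (pos s + 1 :: s)) (psi_trap (pos s - 1 :: s))).
  + by apply: IHn; [rewrite e /within; clear; lia|left].
  + by apply: IHn; [rewrite e /within; clear; lia|right].
  rewrite /psi_trap /up /dn e /=; zr e.
  rewrite ![1 + _]addrC psi0_step //; lra.
- apply: (@Ev_step _ _ _ _ (psi_trap (pos s + 1 :: s)) (psi_trap (pos s - 1 :: s))).
  + by apply: IHn; [rewrite e /within; clear; lia|left].
  + by apply: IHn; [rewrite e /within; clear; lia|right].
  move: h inv'; rewrite /psi_trap /up /dn e /=; zr e => h inv'.
  rewrite ![1 + _]addrC [leLHS]addrC.
  have -> : v + 1 - 1 = v by clear; lia.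
  have -> : v + 1 + 1 = v + 2 by clear; lia.
  apply: psi1_step => //; lra.
- apply: (@Ev_step _ _ _ _ (psi_trap (pos s + 1 :: s)) (psi_trap (pos s - 1 :: s))).
  + by apply: IHn; [rewrite e /within; clear; lia|left].
  + by apply: IHn; [rewrite e /within; clear; lia|right].
  move: h inv'; rewrite /psi_trap /up /dn e /=; zr e => h inv'.
  have -> : v - 1 - 1 = v - 2 by clear; lia.
  have -> : v - 1 + 1 = v by clear; lia.
  rewrite ![1 + _]addrC psi0C [Zr s (v - 2) + _]addrC.
  apply: psi1_step => //; lra.
- apply: (@Ev_step _ _ _ _ 1 (psi_trap (pos s - 1 :: s))).
  + by rewrite subrr Ev_ge0.
  + by apply: IHn; [rewrite e /within; clear; lia|right].
  rewrite /psi_trap /up /dn e /=; zr e.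
  have -> : v + 2 - 1 = v + 1 by clear; lia.
  have -> : Zr s (v + 2 + 1) = 1.
    rewrite /Zr occ_notin //; apply/negP => hs; move/allP: sb => /(_ _ hs).
    by rewrite /within; clear; lia.
  apply: le_trans (psi2_step _ _ _ _); try lra.
  by rewrite mulr1 div1r addrC [1 + _]addrC.
apply: (@Ev_step _ _ _ _ (psi_trap (pos s + 1 :: s)) 1).
+ by apply: IHn; [rewrite e /within; clear; lia|left].
+ by rewrite subrr Ev_ge0.
rewrite /psi_trap /up /dn e /=; zr e.
have -> : v - 2 + 1 = v - 1 by clear; lia.
have -> : Zr s (v - 2 - 1) = 1.
  rewrite /Zr occ_notin //; apply/negP => hs; move/allP: sb => /(_ _ hs).
  by rewrite /within; clear; lia.
apply: le_trans (psi2_step _ _ _ _); try lra.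
by rewrite mulr1 div1r [1 + _]addrC.
Qed.

(** In order of time: k rounds v, v + 1, v, v - 1, v, then for [trapped] one excursion to v + 2 and
    one to v - 2. All five sites get visited, and v - 1 and v + 1 end with equal weights, large with
    k. *)
Definition bounces k : seq int :=
  iter k (fun s => [:: v, v - 1, v, v + 1 & s]) [:: v].
Definition trapped k : seq int :=
  [:: v, v - 1, v - 2, v - 1, v, v + 1, v + 2, v + 1 & bounces k].

Lemma occ_bounces k :
  [/\ occ (bounces k) v = (k.*2 + 2)%N, occ (bounces k) (v - 1) = k.+1,
     occ (bounces k) (v + 1) = k.+1, occ (bounces k) (v - 2) = 1%N
     & occ (bounces k) (v + 2) = 1%N].
Proof.
elim: k => [|k [h1 h2 h3 h4 h5]]; rewrite /= ?occ_cons ?h1 ?h2 ?h3 ?h4 ?h5;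
  rewrite ?(@occ_notin [::]) //; split; lia.
Qed.

Lemma all_within_trapped k : all within (trapped k).
Proof.
have h : all within (bounces k).
  by elim: k => [|k IH] /=; rewrite ?IH ?andbT /within; lia.
by rewrite /trapped /= h /within; lia.
Qed.

(** B = C = k + 3 and D = E = 2, so the potential is [4 / (2 * C + 1) + 160 / C], below [9 / 10] for
    C >= 203. *)
Lemma good_trapped k : (200 <= k)%N -> good (all within) 10^-1 (trapped k).
Proof.
move=> k200 n; have [h1 h2 h3 h4 h5] := occ_bounces k.
have e1 : occ (trapped k) v = (k.*2 + 4)%N by rewrite /trapped !occ_cons h1; lia.
have e2 : occ (trapped k) (v - 1) = (k + 3)%N by rewrite /trapped !occ_cons h2; lia.
have e3 : occ (trapped k) (v + 1) = (k + 3)%N by rewrite /trapped !occ_cons h3; lia.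
have e4 : occ (trapped k) (v - 2) = 2%N by rewrite /trapped !occ_cons h4; lia.
have e5 : occ (trapped k) (v + 2) = 2%N by rewrite /trapped !occ_cons h5; lia.
have : 1 - psi_trap (trapped k) <= Ev n (all within) (trapped k).
  apply: Ev_trap; rewrite ?e1 ?e2 ?e3 ?e4 ?e5 ?all_within_trapped //; lia.
apply: le_trans; rewrite /psi_trap /= eqxx /psi0 /spread /Zr e2 e3 e4 e5.
have : 203 <= (k + 3)%:R :> R by rewrite ler_nat; lia.
move: (k + 3)%:R => C C203.
have -> : 4 * (((C - C) ^+ 2 + (C + C)) / ((C + C) * (C + C + 1))) = 4 / (2 * C + 1).
  by field; rewrite ?gt_eqF //=; lra.
have h : 2 / C <= 2 / 203 by rewrite ler_pM2l ?lef_pV2 ?posrE; lra.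
have h' : 4 / (2 * C + 1) <= 4 / 200 by rewrite ler_pM2l ?lef_pV2 ?posrE; lra.
lra.
Qed.

End Trap.

End Paths.

(** * Finite trajectories in the probability space *)

Section PathLaw.
Context d (T : measurableType d) (R : realType) (P : probability T R).

Lemma le_prob (A B : set T) :
  measurable A -> measurable B -> A `<=` B -> (P A <= P B)%E.
Proof. by move=> mA mB AB; rewrite le_measure ?inE. Qed.

Fixpoint traj (Y : nat -> T -> int) n w : seq int :=
  if n is n'.+1 then Y n w :: traj Y n' w else [:: Y 0%N w].

Lemma all_traj (q : pred int) Y n w :
  all q (traj Y n w) <-> forall i, (i <= n)%N -> q (Y i w).
Proof.
elim: n => [|n IH] /=.
  rewrite andbT; split=> [h i|]; last exact.
  by rewrite leqn0 => /eqP ->.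
split=> [/andP[h /IH ht] i|h].
  by rewrite leq_eqVlt => /orP[/eqP ->|]; [|exact: ht].
by apply/andP; split; [exact: h|apply/IH => i ni; apply: h; exact: leqW].
Qed.

Lemma all_traj_setE (q : pred int) Y :
  [set w | forall n, q (Y n w)] = \bigcap_n [set w | all q (traj Y n w)].
Proof.
apply/seteqP; split=> w /= h; first by move=> n _; apply/all_traj.
by move=> n; have /all_traj := h n I; apply.
Qed.

Section Law.
Variables (v : int) (Y : nat -> T -> int).
Hypothesis mY : forall n x, measurable [set w | Y n w = x].

Lemma measurable_pos (q : pred int) n : measurable [set w | q (Y n w)].
Proof.
rewrite (_ : [set w | _] =
    \bigcup_(x : int) if q x then [set w | Y n w = x] else set0).
  by apply: countable_bigcupT_measurable => // x; case: ifP.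
apply/seteqP; split=> [w /= h|w [x _]]; first by exists (Y n w) => //; rewrite h.
by case: ifP => //= qx ->.
Qed.

Lemma measurable_traj_eq n s : measurable [set w | traj Y n w = s].
Proof.
elim: n s => [|n IH] [|x s] /=; try by rewrite [X in measurable X](_ : _ = set0) //;
  apply/seteqP; split.
  have [->|sn] := eqVneq s [::].
    rewrite (_ : [set w | _] = [set w | Y 0%N w = x]) //.
    by apply/seteqP; split=> w /= => [[]|->].
  rewrite [X in measurable X](_ : _ = set0) //.
  by apply/seteqP; split=> w //= [_ e]; rewrite -e eqxx in sn.
rewrite [X in measurable X](_ : _ =
    [set w | Y n.+1 w = x] `&` [set w | traj Y n w = s]).
  exact: measurableI.
by apply/seteqP; split=> w /= [-> ->].
Qed.

Lemma measurable_traj (q : pred (seq int)) n : measurable [set w | q (traj Y n w)].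
Proof.
rewrite (_ : [set w | _] =
    \bigcup_(s : seq int) if q s then [set w | traj Y n w = s] else set0).
  apply: countable_bigcupT_measurable => // s; case: ifP => // _.
  exact: measurable_traj_eq.
apply/seteqP; split=> [w /= h|w [s _]]; first by exists (traj Y n w) => //; rewrite h.
by case: ifP => //= qs ->.
Qed.

(** Masses of single trajectories replace conditional probabilities: this form matches the recursion
    of [Ev] and is preserved by reflection. *)
Definition path_law :=
  P [set w | Y 0%N w = v] = 1%E /\
  forall n s, s <> [::] ->
    P [set w | traj Y n.+1 w = pos s + 1 :: s] =
      ((up R s)%:E * P [set w | traj Y n w = s])%E /\
    P [set w | traj Y n.+1 w = pos s - 1 :: s] =
      ((dn R s)%:E * P [set w | traj Y n w = s])%E.

Hypothesis lawY : path_law.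

Lemma traj_ge_Ev q n k s : s <> [::] ->
  ((Ev R n q s)%:E * P [set w | traj Y k w = s] <=
   P ([set w | traj Y k w = s] `&` [set w | q (traj Y (k + n) w)]))%E.
Proof.
elim: n k s => [|n IH] k s s0 /=.
  rewrite addn0; case qs : (q s); last by rewrite mul0e measure_ge0.
  rewrite mul1e le_eqVlt; apply/orP; left; apply/eqP; congr (P _).
  by apply/seteqP; split=> w /= => [->|[]].
have [hu hd] := lawY.2 k s s0.
pose A x := [set w | traj Y k.+1 w = x :: s] `&` [set w | q (traj Y (k.+1 + n) w)].
have mA x : measurable (A x).
  by apply: measurableI; [exact: measurable_traj_eq|exact: measurable_traj].
apply: (@le_trans _ _ (P (A (pos s + 1) `|` A (pos s - 1)))).
  rewrite measureU //; last first.
    apply/seteqP; split=> // w /= [[/= [e1 _] _] [/= [e2 _] _]].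
    by move: e2; rewrite e1; lia.
  have u0 := ltW (up_gt0 R s); have d0 := ltW (dn_gt0 R s).
  rewrite EFinD ge0_muleDl ?lee_fin ?(mulr_ge0 u0) ?(mulr_ge0 d0) ?Ev_ge0 //.
  rewrite [up R s * _]mulrC [dn R s * _]mulrC ![(Ev _ _ _ _ * _)%:E]EFinM.
  rewrite -!muleA -hu -hd.
  by apply: leeD; exact: IH.
apply: le_prob.
- exact: measurableU.
- by apply: measurableI; [exact: measurable_traj_eq|exact: measurable_traj].
by move=> w /= [] [] /= [_ ->]; rewrite addnS.
Qed.

Lemma bigcap_ge (F : (set T)^nat) (c : \bar R) : (forall n, measurable (F n)) ->
  (forall n, F n.+1 `<=` F n) -> (forall n, c <= P (F n))%E ->
  (c <= P (\bigcap_n F n))%E.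
Proof.
move=> mF dF cF.
have h : P \o F @ \oo --> P (\bigcap_n F n).
  apply: nonincreasing_cvg_mu => //.
  - by rewrite (le_lt_trans (probability_le1 _ _)) ?ltry.
  - exact: bigcap_measurable.
  - by apply/nonincreasing_seqP => n; apply/subsetPset; exact: dF.
rewrite -(cvg_lim _ h) //; apply: lime_ge; first by apply/cvg_ex; eexists; exact: h.
by apply: nearW => n; exact: cF.
Qed.

Lemma bounded_above_ge (k : nat) (c : R) :
  (forall n, c <= Ev R n (all (below (v + 2 + 4 * k%:Z))) [:: v]) ->
  (c%:E <= P [set w | forall n, below (v + 2 + 4 * k%:Z) (Y n w)])%E.
Proof.
move=> h; rewrite all_traj_setE; apply: bigcap_ge.
- by move=> n; exact: measurable_traj.
- by move=> n w /= /andP[].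
move=> n; apply: (@le_trans _ _ ((Ev R n (all (below (v + 2 + 4 * k%:Z))) [:: v])%:E)).
  by rewrite lee_fin.
have e0 : [set w | traj Y 0 w = [:: v]] = [set w | Y 0%N w = v].
  by apply/seteqP; split=> w /= => [[]|->].
have := @traj_ge_Ev (all (below (v + 2 + 4 * k%:Z))) n 0 [:: v].
rewrite e0 lawY.1 mule1 => /(_ _) /le_trans; apply => //.
apply: le_prob.
- by apply: measurableI => //; exact: measurable_traj.
- exact: measurable_traj.
exact: subIsetr.
Qed.

Definition bounded_above := [set w | exists k : nat, forall n, Y n w < v + k%:Z].

Lemma measurable_bounded_above : measurable bounded_above.
Proof.
rewrite (_ : bounded_above = \bigcup_k \bigcap_n [set w | below (v + k%:Z) (Y n w)]).
  apply: bigcup_measurable => k _; apply: bigcap_measurable => // n _.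
  exact: measurable_pos.
apply/seteqP; split=> w /= [k]; first by move=> h; exists k => // n _; exact: h.
by move=> _ h; exists k => n; exact: h.
Qed.

Lemma bounded_above1 : P bounded_above = 1%E.
Proof.
have [c /andP[c0 c1] H] := Ev_below_geometric R.
have mB := measurable_bounded_above.
apply/eqP; rewrite eq_le probability_le1 //=.
apply/lee_addgt0Pr => e e0.
have c1' : 0 <= 1 - c by rewrite subr_ge0.
have [k hk] : exists k, (1 - c) ^+ k < e.
  have : (GRing.exp (1 - c) : R ^nat) @ \oo --> (0 : R).
    by apply: cvg_expr; rewrite ger0_norm; lra.
  move=> /cvgrPdist_lt /(_ _ e0) [k _ /(_ k (leqnn _))] /=.
  rewrite sub0r normrN ger0_norm ?exprn_ge0 // => hk.
  by exists k.
have h1 : ((1 - e)%:E <= P bounded_above)%E.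
  apply: (@le_trans _ _ (P [set w | forall n, below (v + 2 + 4 * k%:Z) (Y n w)])).
    apply: bounded_above_ge => n.
    by rewrite lerBlDr -lerBlDl (le_trans (H n v k)) // ltW.
  apply: le_prob.
  - rewrite all_traj_setE; apply: bigcap_measurable => // n _.
    exact: measurable_traj.
  - exact: measurable_bounded_above.
  move=> w /= h; exists (2 + 4 * k)%N => n; have := h n; rewrite /below; lia.
by rewrite -leeBlDr // -EFinB.
Qed.

End Law.

Fixpoint nn_path v s : bool :=
  match s with
  | [::] => false
  | x :: t => if t is [::] then x == v
              else ((x == pos t + 1) || (x == pos t - 1)) && nn_path v t
  end.

Lemma nn_path_gt0 v Y s : path_law v Y -> nn_path v s ->
  (0 < P [set w | traj Y (size s).-1 w = s])%E.
Proof.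
move=> [h0 h]; elim: s => // x [|y t] IH.
  move=> /eqP -> /=; rewrite (_ : [set w | _] = [set w | Y 0%N w = v]) ?h0 //.
  by apply/seteqP; split=> w /= => [[]|->].
set s := y :: t => /= /andP[/orP[]/eqP -> /IH /= {}IH];
  have [hu hd] := h (size t) s ltac:(by []).
  by move: hu; rewrite /= => ->; rewrite mule_gt0 // lte_fin up_gt0.
by move: hd; rewrite /= => ->; rewrite mule_gt0 // lte_fin dn_gt0.
Qed.

End PathLaw.

(** * Reflection of the line *)

Lemma occ_opp s x : occ (map -%R s) x = occ s (- x).
Proof.
rewrite /occ count_map; congr _.+1; apply: eq_count => y /=.
by rewrite eqr_oppLR.
Qed.

Lemma pos_opp s : pos (map -%R s) = - pos s.
Proof. by case: s => //=; rewrite oppr0. Qed.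

Lemma up_opp (R : realFieldType) s : up R (map -%R s) = dn R s.
Proof.
rewrite /up /dn /Zr !occ_opp pos_opp !opprD !opprK.
by rewrite [X in _ / X]addrC.
Qed.

Lemma dn_opp (R : realFieldType) s : dn R (map -%R s) = up R s.
Proof. by rewrite -up_opp mapK //; exact: opprK. Qed.

Section Reflection.
Context d (T : measurableType d) (R : realType) (P : probability T R).
Variables (v : int) (Y : nat -> T -> int).

Lemma traj_opp n w : traj (fun n w => - Y n w) n w = map -%R (traj Y n w).
Proof. by elim: n => //= n ->. Qed.

Lemma traj_oppE n s :
  [set w | traj (fun n w => - Y n w) n w = s] = [set w | traj Y n w = map -%R s].
Proof.
apply/seteqP; split=> w /=; rewrite traj_opp.
  by move=> <-; rewrite mapK //; exact: opprK.
by move=> ->; rewrite mapK //; exact: opprK.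
Qed.

(** Negating a history exchanges [up] and [dn]. *)
Lemma path_law_opp : path_law P v Y -> path_law P (- v) (fun n w => - Y n w).
Proof.
move=> [h0 h]; split.
  rewrite -h0; congr (P _); apply/seteqP; split=> w /=.
    by move/oppr_inj.
  by move=> ->.
move=> n s s0; have [hu hd] := h n (map -%R s) ltac:(by case: s s0).
rewrite !traj_oppE /= -[up R s]dn_opp -[dn R s]up_opp -hu -hd pos_opp.
by rewrite !opprD !opprK.
Qed.

End Reflection.

(** * The trajectory law of VRRW *)

Section VRRWLaw.
Context d (T : measurableType d) (R : realType) (P : probability T R).
Variables (v : int) (X : nat -> {RV P >-> int}).
Hypothesis vX : VRRW v X.

Let Y n w : int := X n w.

Lemma measurable_RV n x : measurable [set w | Y n w = x].
Proof.
have := @measurable_funPTI _ _ _ _ (X n) [set x] I.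
by [].
Qed.

Lemma history_traj n s : <<s history X n >> [set w | traj Y n w = s].
Proof.
pose G := g_sigma_algebraType (history X n).
have mG i x : (i <= n)%N -> @measurable _ G [set w | Y i w = x].
  move=> ni; apply: sub_sigma_algebra; exists i => //; exists [set x] => //.
  by rewrite setTI.
(* The sigma-algebra stays that of time n while the induction runs over shorter trajectories. *)
suff H k t : (k <= n)%N -> @measurable _ G [set w | traj Y k w = t] by exact: H.
elim: k t => [|k IH] [|x t] kn /=.
- by rewrite [X in measurable X](_ : _ = set0) //; apply/seteqP; split.
- have [->|tn] := eqVneq t [::].
    rewrite (_ : [set w | _] = [set w | Y 0%N w = x]); first exact: mG.
    by apply/seteqP; split=> w /= => [[]|->].
  rewrite [X in measurable X](_ : _ = set0) //.
  by apply/seteqP; split=> w //= [_ e]; rewrite -e eqxx in tn.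
- by rewrite [X in measurable X](_ : _ = set0) //; apply/seteqP; split.
rewrite [X in measurable X](_ : _ =
    [set w | Y k.+1 w = x] `&` [set w | traj Y k w = t]).
  by apply: measurableI; [exact: mG|apply: IH; exact: ltnW].
by apply/seteqP; split=> w /= [-> ->].
Qed.

Lemma occupation_traj n x w : occupation X n x w = occ (traj Y n w) x.
Proof.
rewrite /occupation /occ add1n; congr _.+1.
elim: n => [|n IH]; first by rewrite big_nat1 /= addn0.
by rewrite big_nat_recr //= IH addnC.
Qed.

Lemma pos_traj n w : pos (traj Y n w) = X n w.
Proof. by case: n. Qed.

Lemma Zadj_set (x : int) : [set y | Zadj y x] = [set x - 1] `|` [set x + 1].
Proof.
apply/seteqP; split=> y /=; rewrite /Zadj; first by move=> /eqP h; lia.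
by move=> [] ->; lia.
Qed.

Lemma vrrw_step_traj n x w : Zadj x (X n w) ->
  vrrw_step R X n x w =
  Zr R (traj Y n w) x / (Zr R (traj Y n w) (pos (traj Y n w) - 1) +
                       Zr R (traj Y n w) (pos (traj Y n w) + 1)).
Proof.
move=> adj; rewrite /vrrw_step adj mul1r Zadj_set fsbigU0 //; last first.
  by move=> y /= [-> ]; lia.
by rewrite !fsbig_set1 !occupation_traj pos_traj.
Qed.

(** The event that the trajectory is s lies in the history, and the step probability is constant on
    it, so its integral there is a product. *)
Lemma VRRW_path_law : path_law P v Y.
Proof.
have [h0 h] := vX; split.
  case: h0 => N [mN N0 sub].
  have mA := measurable_RV 0 v.
  have : P (~` [set w | Y 0%N w = v]) = 0%E.
    apply/eqP; rewrite eq_le measure_ge0 andbT -N0.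
    by apply: le_prob => //; exact: measurableC.
  by rewrite probability_setC // => /eqP; rewrite sube_eq ?add0e ?fin_num_measure //;
    move=> /eqP.
move=> n s s0.
have key x c : (x = pos s + 1 \/ x = pos s - 1) ->
    c = Zr R s x / (Zr R s (pos s - 1) + Zr R s (pos s + 1)) ->
    P [set w | traj Y n.+1 w = x :: s] = (c%:E * P [set w | traj Y n w = s])%E.
  move=> hx cE; have [_ _ hc] := h n x.
  have mA : measurable [set w | traj Y n w = s].
    by apply: measurable_traj_eq; exact: measurable_RV.
  rewrite (_ : [set w | traj Y n.+1 w = _] =
      [set w | X n.+1 w = x] `&` [set w | traj Y n w = s]); last first.
    by apply/seteqP; split=> w /= [e1 e2]; [split|congr (_ :: _)].
  rewrite -hc; last exact: history_traj.
  rewrite -integral_cst //; apply: eq_integral => w; rewrite inE /= => e.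
  rewrite cE vrrw_step_traj ?e //; rewrite -pos_traj e /Zadj.
  by case: hx => ->; lia.
by split; apply: key; auto.
Qed.

End VRRWLaw.

(** * A five-point range with positive probability *)

Lemma nn_path_trapped v k : nn_path v (trapped v k).
Proof.
have h : pos (bounces v k) = v /\ nn_path v (bounces v k).
  elim: k => [|k [e IH]] /=; first by rewrite eqxx.
  case: (bounces v k) e IH => // x t /= -> ->; rewrite andbT; split => //; lia.
case: h; rewrite /trapped; case: (bounces v k) => // x t /= -> ->.
rewrite andbT; lia.
Qed.

Lemma mem_traj d (T : measurableType d) (Y : nat -> T -> int) n w x :
  x \in traj Y n w -> exists i, Y i w = x.
Proof.
elim: n => [|n IH] /=; first by rewrite inE => /eqP ->; exists 0%N.
by rewrite inE => /orP[/eqP ->|/IH //]; exists n.+1.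
Qed.

Lemma within_trapped v k x : within v x -> x \in trapped v k.
Proof.
rewrite /within /trapped !inE => h.
have : [|| x == v, x == v - 1, x == v - 2, x == v + 1 | x == v + 2] by lia.
by case/or4P => [->|->|->|/orP[]->]; rewrite ?orbT.
Qed.

Definition trap_sites (v : int) : {fset int} :=
  [fset x in [:: v; v - 1; v - 2; v + 1; v + 2]%R]%fset.

Lemma trap_sitesE v : [set` trap_sites v] = [set x | within v x].
Proof.
by apply/seteqP; split=> x /=; rewrite /trap_sites /within !inE; lia.
Qed.

Lemma card_trap_sites v : #|` trap_sites v| = 5%N.
Proof.
rewrite /trap_sites card_fseq undup_id //= !inE; lia.
Qed.

Section Trapping.
Context d (T : measurableType d) (R : realType) (P : probability T R).
Variables (v : int) (Y : nat -> T -> int).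
Hypothesis mY : forall n x, measurable [set w | Y n w = x].
Hypothesis lawY : path_law P v Y.

(** Countably many conditions suffice: every position lies in F, and every point of F is hit. *)
Lemma measurable_visited_eq (F : {fset int}) :
  measurable [set w | visited Y w = [set` F]].
Proof.
rewrite (_ : [set w | _] = (\bigcap_n [set w | Y n w \in F]) `&`
   (\bigcap_(x : int) if x \in F then \bigcup_n [set w | Y n w = x] else setT)).
  apply: measurableI.
    by apply: bigcap_measurable => // n _; exact: (measurable_pos mY).
  rewrite -[X in measurable X]setCK setC_bigcap; apply: measurableC.
  apply: countable_bigcupT_measurable => // x; apply: measurableC.
  by case: ifP => // _; exact: bigcup_measurable.
apply/seteqP; split=> w /=.
  move=> e; split=> [n _|x _] /=.
    by suff : [set` F] (Y n w) by []; rewrite -e; exists n.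
  case: ifP => // xF; have : visited Y w x by rewrite e.
  by case=> n h; exists n.
move=> [h1 h2]; apply/seteqP; split=> [x [n <-]|x /= xF]; first exact: h1.
by have := h2 x I; rewrite xF => -[n _ h]; exists n.
Qed.

Lemma measurable_visited_card n : measurable [set w | (visited Y w #= `I_n)%card].
Proof.
rewrite (_ : [set w | _] = \bigcup_(F : {fset int})
    if #|` F| == n then [set w | visited Y w = [set` F]] else set0).
  apply: countable_bigcupT_measurable => // F.
  by case: ifP => // _; exact: measurable_visited_eq.
apply/seteqP; split=> w /=.
  move=> h; have [F e] : exists F : {fset int}, visited Y w = [set` F].
    by apply/finite_fsetP/finite_setP; exists n.
  by exists F => //; move: h; rewrite e => /card_eq_fsetP ->; rewrite eqxx.
by move=> [F _]; case: ifP => // /eqP nF ->; apply/card_eq_fsetP.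
Qed.

(** The path s has positive mass, and confinement afterwards keeps at least a share c of it. *)
Lemma trapped_gt0 (q : pred int) s (c : R) : nn_path v s -> 0 < c ->
  good (all q) c s ->
  (0 < P ([set w | traj Y (size s).-1 w = s] `&` [set w | forall n, q (Y n w)]))%E.
Proof.
move=> ns c0 gs; have s0 : s <> [::] by case: s ns {gs}.
have Ps := nn_path_gt0 lawY ns.
set k := (size s).-1 in Ps *.
pose F n := [set w | traj Y k w = s] `&` [set w | all q (traj Y (k + n) w)].
apply: (@lt_le_trans _ _ (c%:E * P [set w | traj Y k w = s])%E).
  by rewrite mule_gt0.
apply: (@le_trans _ _ (P (\bigcap_n F n))).
  apply: bigcap_ge.
  - by move=> n; apply: measurableI; [exact: measurable_traj_eq|exact: measurable_traj].
  - by move=> n w [/= e]; rewrite addnS => /andP[_ h].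
  move=> n; apply: le_trans (traj_ge_Ev mY lawY _ _ _ s0).
  by rewrite lee_pmul2r ?lee_fin // fin_num_measure //; exact: measurable_traj_eq.
apply: le_prob.
- apply: bigcap_measurable => // n _.
  by apply: measurableI; [exact: measurable_traj_eq|exact: measurable_traj].
- apply: measurableI; first exact: measurable_traj_eq.
  by rewrite all_traj_setE; apply: bigcap_measurable => // n _; exact: measurable_traj.
move=> w h; split; first by have [] := h 0%N I.
move=> n; have [_ /all_traj] := h n I; apply; exact: leq_addl.
Qed.

Lemma visited5 : (0 < P [set w | (visited Y w #= `I_5)%card])%E.
Proof.
have := trapped_gt0 (nn_path_trapped v 200) _ (good_trapped R v (leqnn 200)).
rewrite invr_gt0 ltr0n => /(_ isT) /lt_le_trans; apply.
move: 200%N => k.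
apply: le_prob.
- apply: measurableI; first exact: measurable_traj_eq.
  by rewrite all_traj_setE; apply: bigcap_measurable => // n _; exact: measurable_traj.
- exact: measurable_visited_card.
move=> w [e h]; rewrite /= (_ : visited Y w = [set` trap_sites v]).
  by apply/card_eq_fsetP; exact: card_trap_sites.
rewrite trap_sitesE; apply/seteqP; split=> [x [n <-]|x /= xv]; first exact: h.
have : x \in traj Y (size (trapped v k)).-1 w by rewrite e within_trapped.
exact: mem_traj.
Qed.

End Trapping.

Theorem theorem1p1 (d : measure_display) (T : measurableType d) (R : realType)
    (P : probability T R) (v : int) (X : nat -> {RV P >-> int}) :
  VRRW v X ->
  (0 < P [set w | (visited X w #= `I_5)%card])%E /\
  P [set w | finite_set (visited X w)] = 1%E.
Proof.
move=> vX; pose Y n w : int := X n w.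
have lawY : path_law P v Y := VRRW_path_law vX.
have mY : forall n x, measurable [set w | Y n w = x] by exact: measurable_RV.
split; first exact: visited5 mY lawY.
pose Y' n w := - Y n w.
have mY' n x : measurable [set w | Y' n w = x].
  rewrite (_ : [set w | _] = [set w | Y n w = - x]) //.
  by apply/seteqP; split=> w /=; rewrite /Y' => h; lia.
have mA := measurable_bounded_above v mY.
have mB := measurable_bounded_above (- v) mY'.
have A1 := bounded_above1 mY lawY.
have B1 := bounded_above1 mY' (path_law_opp lawY).
have nul C : measurable C -> P C = 1%E -> P (~` C) = 0%E.
  by move=> mC C1; rewrite probability_setC // C1 subee.
(* Finite means bounded on both sides; [Y'] turns the lower bound into an upper one. *)
have -> : [set w | finite_set (visited X w)] =
    bounded_above v Y `&` bounded_above (- v) Y'.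
  apply/seteqP; split=> w /=.
    move=> /finite_seqP[s e].
    have h n : X n w \in s by suff : [set` s] (X n w) by []; rewrite -e; exists n.
    have b x : x \in s -> (absz (x - v)%R <= \max_(y <- s) absz (y - v)%R)%N.
      by move=> xs; exact: (@leq_bigmax_seq _ _ _ (fun y : int => absz (y - v)%R)).
    split; exists (\max_(y <- s) absz (y - v)%R).+1 => n; have := b _ (h n);
      rewrite /Y' /Y; lia.
  (* The range lies among the k + l integers from v - l on. *)
  move=> [[k hk] [l hl]]; apply: (@sub_finite_set _ _
     [set` [seq v - l%:Z + i%:Z | i <- iota 0 (k + l)]]); last exact: finite_seq.
  move=> x [n <-] /=; apply/mapP; exists (absz (X n w - (v - l%:Z))%R).
    by rewrite mem_iota; have := hk n; have := hl n; rewrite /Y' /Y; lia.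
  by have := hk n; have := hl n; rewrite /Y' /Y; lia.
set A := bounded_above v Y in mA A1 *.
set B := bounded_above (- v) Y' in mB B1 *.
have mAB : measurable (~` A `|` ~` B) by apply: measurableU; exact: measurableC.
have AB0 : P (~` A `|` ~` B) = 0%E.
  apply: measure_negligible => //.
  by apply: negligibleU; apply/negligibleP; try exact: measurableC; exact: nul.
by rewrite -[A `&` B]setCK setCI probability_setC // AB0 sube0.
Qed.
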